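(* Let $\Omega\subset\mathbb{R}^n\times\mathbb{R}$ be a bounded domain, let $\zeta_0=(x_0,t_0)\in\partial\Omega$, and suppose that there exist $(x',t')\in\mathbb{R}^n\times\mathbb{R}$ and $R_0>0$ such that the closed ball $$\{(x,t):\ |x-x'|^2+(t-t')^2\le R_0^2\}$$ intersects $\overline{\Omega}$ precisely at $\zeta_0$. Assume that $\zeta_0$ is not the south pole of the ball, i.e. $(x_0,t_0)\ne(x',t'-R_0)$, and that, in case $\zeta_0$ is the north pole, i.e. $(x_0,t_0)=(x',t'+R_0)$, the radius satisfies $R_0\ge1$. Then $\zeta_0$ is a regular boundary point of $\Omega$ for the normalised $\infty$-heat equation $u_t-\Delta_\infty^N u=0$.
   Context: Points of $\mathbb{R}^n\times\mathbb{R}$ are written $\zeta=(x,t)$; $D$ and $D^2$ are the gradient and Hessian in the spatial variable $x$ only; $\partial\Omega$ is the Euclidean boundary in $\mathbb{R}^{n+1}$. For $D\psi\ne0$, $\Delta_\infty^N\psi=\frac{1}{|D\psi|^2}\sum_{i,j=1}^n\psi_{x_i}\psi_{x_j}\psi_{x_ix_j}$. For a symmetric matrix $X$, $\Lambda(X)$ is its largest eigenvalue. An upper semicontinuous $u:\Omega\to\mathbb{R}\cup\{-\infty\}$ is a (viscosity) subsolution in $\Omega$ if for every $\psi\in C^2(\Omega)$ such that $u-\psi$ has a maximum at $\zeta_0\in\Omega$ one has $\psi_t(\zeta_0)-\Delta_\infty^N\psi(\zeta_0)\le0$ if $D\psi(\zeta_0)\neq0$, and $\psi_t(\zeta_0)-\Lambda(D^2\psi(\zeta_0))\le0$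 if $D\psi(\zeta_0)=0$. Lower Perron solution: for $f:\partial\Omega\to\mathbb{R}$ continuous, the lower class $\mathcal{L}_f$ consists of all subsolutions $v$ in $\Omega$ with $\limsup_{\eta\to\zeta,\,\eta\in\Omega}v(\eta)\le f(\zeta)$ for all $\zeta\in\partial\Omega$, and $\underline{H}_f(\zeta)=\sup\{v(\zeta):v\in\mathcal{L}_f\}$ for $\zeta\in\Omega$. Regular point: $\zeta_0\in\partial\Omega$ is a regular boundary point of $\Omega$ if $\lim_{\zeta\to\zeta_0,\,\zeta\in\Omega}\underline{H}_f(\zeta)=f(\zeta_0)$ for every continuous $f:\partial\Omega\to\mathbb{R}$. *)

(* Defs.v *)
From HB Require Import structures.
From mathcomp Require Import all_boot all_order all_algebra.
From mathcomp Require Import all_classical all_reals all_analysis.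

Set Implicit Arguments.
Unset Strict Implicit.
Unset Printing Implicit Defensive.

Import Order.TTheory GRing.Theory Num.Theory.
Import numFieldNormedType.Exports.

Local Open Scope classical_set_scope.
Local Open Scope ring_scope.

(* The library norm on ['rV[R]_n * R] is the maximum norm; it is used only
   through the topology and the notion of bounded set, which are the Euclidean
   ones.  Euclidean lengths are written out with [sqdist]. *)
Definition spacetime (R : realType) (n : nat) : normedModType R :=
  ('rV[R]_n * R)%type.

Section spacetime_defs.
Context {R : realType} {n : nat}.
Local Notation ST := (spacetime R n).
Implicit Types (Omega : set ST) (z zeta : ST) (psi f : ST -> R).

Definition sqdist z zeta : R :=
  \sum_(i < n) (z.1 0 i - zeta.1 0 i) ^+ 2 + (z.2 - zeta.2) ^+ 2.

Definition euclidean_closed_ball zeta (r : R) : set ST :=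
  [set z | sqdist z zeta <= r ^+ 2].

Definition boundary Omega : set ST := closure Omega `\` Omega°.

Definition domain Omega : Prop :=
  [/\ Omega !=set0, open Omega & connected Omega].

(* [Some i] is the direction of [x_i], [None] that of [t]. *)
Definition dir (k : option 'I_n) : ST :=
  if k is Some i then (delta_mx 0 i, 0) else (0, 1).

Definition pderiv (k : option 'I_n) psi : ST -> R := 'D_(dir k) psi.

Definition C1_on Omega psi : Prop :=
  forall k z, Omega z ->
    derivable psi z (dir k) /\ {for z, continuous (pderiv k psi)}.

Definition C2_on Omega psi : Prop :=
  C1_on Omega psi /\ forall k, C1_on Omega (pderiv k psi).

Definition Dt psi z : R := pderiv None psi z.

Definition grad psi z : 'rV[R]_n := \row_i pderiv (Some i) psi z.

Definition hessian psi z : 'M[R]_n :=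
  \matrix_(i, j) pderiv (Some j) (pderiv (Some i) psi) z.

Definition norm_inf_laplacian psi z : R :=
  (\sum_(i < n) grad psi z 0 i ^+ 2)^-1 *
  \sum_(i < n) \sum_(j < n)
    grad psi z 0 i * grad psi z 0 j * hessian psi z i j.

(* For a symmetric [X] of positive size the set of eigenvalues is finite and
   nonempty, so this supremum is a maximum. *)
Definition largest_eigenvalue (X : 'M[R]_n) : R := sup [set a | eigenvalue X a].

(* Functions on [Omega] are total functions whose values outside [Omega] are
   irrelevant. *)
Definition usc_on Omega (u : ST -> \bar R) : Prop :=
  forall z, Omega z -> forall a : R, (u z < a%:E)%E ->
    \forall y \near within Omega (nbhs z), (u y < a%:E)%E.

(* A maximum with value [-oo] occurs only if [g] is identically [-oo] on
   [Omega]; hence the constant [-oo] is not a subsolution below. *)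
Definition max_at Omega (g : ST -> \bar R) zeta : Prop :=
  Omega zeta /\ forall z, Omega z -> (g z <= g zeta)%E.

Definition subsolution Omega (u : ST -> \bar R) : Prop :=
  [/\ forall z, Omega z -> u z != +oo%E,
      usc_on Omega u &
      forall psi zeta, C2_on Omega psi ->
        max_at Omega (fun z => u z - (psi z)%:E)%E zeta ->
        (grad psi zeta != 0 -> Dt psi zeta - norm_inf_laplacian psi zeta <= 0) /\
        (grad psi zeta = 0 ->
           Dt psi zeta - largest_eigenvalue (hessian psi zeta) <= 0)].

Definition lower_class Omega f : set (ST -> \bar R) :=
  [set v | subsolution Omega v /\
    forall zeta, boundary Omega zeta ->
      (limf_esup v (within Omega (nbhs zeta)) <= (f zeta)%:E)%E].

Definition lower_perron Omega f z : \bar R :=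
  ereal_sup [set v z | v in lower_class Omega f].

Definition regular_boundary_point Omega zeta : Prop :=
  boundary Omega zeta /\
  forall f, {within boundary Omega, continuous f} ->
    lower_perron Omega f z @[z --> within Omega (nbhs zeta)] --> (f zeta)%:E.

End spacetime_defs.

(* Main.v *)
(** With zc = (x', t') and rho the Euclidean distance to zc, the barrier is
    w = exp (- al * R0^2) - exp (- al * rho^2), which vanishes at the contact
    point z0 and is positive elsewhere on the closure of Omega.  It is a strict
    classical supersolution wherever 1 < (t - t') + 2 al |x - x'|^2.  If x0 <> x',
    large al gives this near z0; at the north pole al = 1 works on Omega, where
    |x - x'|^2 > R0^2 - (t - t')^2 >= 1 - (t - t')^2.

    No comparison principle for viscosity solutions is needed: f z0 + e + K w is
    smooth and itself serves as a test function, so it lies above every member of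
    the lower class once that class is known to be bounded (by the same argument
    with a Gaussian centred far below Omega).  Conversely the maximum of
    f z0 - e - K w and a large negative constant belongs to the lower class. *)
Require Import Defs.
From HB Require Import structures.
From mathcomp Require Import all_boot all_order all_algebra.
From mathcomp Require Import all_classical all_reals all_analysis.
From mathcomp Require Import ring lra.
Set Implicit Arguments.
Unset Strict Implicit.
Unset Printing Implicit Defensive.
Import Order.TTheory GRing.Theory Num.Theory.
Import numFieldNormedType.Exports.
Local Open Scope classical_set_scope.
Local Open Scope ring_scope.

(** * Calculus along lines *)

Lemma cvg_is_derive {R : realType} {V : normedModType R} (F : V -> R) z v d :
  h^-1 *: (F (h *: v + z) - F z) @[h --> 0^'] --> d -> is_derive z v F d.
Proof.
by move=> Fd; apply: DeriveDef; [apply/cvg_ex; exists d|exact: cvg_lim Fd].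
Qed.

Lemma is_derive_cvg {R : realType} {V : normedModType R} (F : V -> R) z v d :
  is_derive z v F d -> h^-1 *: (F (h *: v + z) - F z) @[h --> 0^'] --> d.
Proof. by case=> /cvg_ex[l Fl] <-; rewrite /derive (cvg_lim _ Fl). Qed.

(** Together with [line_is_derive], this moves directional derivatives to one real variable, where
    the chain rule and the mean value theorem apply. *)
Lemma is_derive_line {R : realType} {V : normedModType R} (F : V -> R)
    z v d (h : R) :
  is_derive (h *: v + z) v F d -> is_derive h 1 (fun s : R => F (s *: v + z)) d.
Proof.
move=> /is_derive_cvg Fd; apply: cvg_is_derive.
apply: cvg_trans Fd; apply: near_eq_cvg; near=> s.
by rewrite /= [s%:A]mulr1 scalerDl addrA.
Unshelve. all: by end_near. Qed.

Lemma line_is_derive {R : realType} {V : normedModType R} (F : V -> R) z v d :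
  is_derive (0 : R) 1 (fun s : R => F (s *: v + z)) d -> is_derive z v F d.
Proof.
move=> /is_derive_cvg Fd; apply: cvg_is_derive.
apply: cvg_trans Fd; apply: near_eq_cvg; near=> s.
by rewrite /= [s%:A]mulr1 addr0 scale0r add0r.
Unshelve. all: by end_near. Qed.

Lemma is_derive_scale_dir {R : realType} {V : normedModType R} (F : V -> R)
    z v d (c : R) :
  is_derive z v F d -> is_derive z (c *: v) F (c * d).
Proof.
move=> Fd; apply: line_is_derive.
rewrite (_ : (fun s => _) = (fun s : R => F (s *: v + z)) \o ( *%R c)); last first.
  by apply/funext => s /=; rewrite scalerA mulrC.
rewrite mulrC; apply: is_derive1_comp.
  by rewrite mulr0; apply: is_derive_line; rewrite scale0r add0r.
have : is_derive (0 : R) 1 (c \*: (id : R -> R)) (c *: 1) by exact: is_deriveZ.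
by rewrite [c *: 1]mulr1.
Qed.

(* Only the partial derivative along [v] has to be continuous: the increment
   along [v] is estimated by the mean value theorem. *)
Lemma is_deriveD_dir {R : realType} {V : normedModType R} (F : V -> R)
    z u v a :
  is_derive z u F a ->
  (\forall y \near z, derivable F y v) -> {for z, continuous ('D_v F)} ->
  is_derive z (u + v) F (a + 'D_v F z).
Proof.
move=> /is_derive_cvg Fu Fv cv; apply: cvg_is_derive.
(* The quotient along [u + v] is split at the intermediate point [h *: u + z]: its first part tends
   to [a], and its second is a quotient along [v] with moving base point. *)
have -> : (fun h => h^-1 *: (F (h *: (u + v) + z) - F z)) =
  (fun h : R => h^-1 *: (F (h *: u + z) - F z)) \+
  (fun h => h^-1 *: (F (h *: v + (h *: u + z)) - F (h *: u + z))).
  apply/funext => h /=; rewrite -scalerDr; congr (_ *: _).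
  by rewrite [RHS]addrC addrA subrK scalerDr addrA (addrC (h *: v)).
apply: cvgD => //; apply/cvgrPdist_le => e e0.
have /cvgrPdist_le /(_ _ e0) cv' := cv.
have : \forall y \near z, derivable F y v /\ `|'D_v F z - 'D_v F y| <= e.
  exact: filterI.
move=> /nbhs_ballP[d /= d0 dP].
(* For [s] in [0, 1] the point [(s * h) *: v + (h *: u + z)] is within |h| (|u| + |v|) of [z]; the
   [+ 1] keeps the divisor positive. *)
have uv0 : 0 < `|u| + `|v| + 1 by rewrite ltr_wpDl.
near=> h.
have h0 : h != 0 by near: h; exact: nbhs_dnbhs_neq.
have hd : `|h| < d / (`|u| + `|v| + 1).
  near: h; apply: dnbhs0_lt; exact: divr_gt0.
have inb (s : R) : 0 <= s <= 1 -> ball z d ((s * h) *: v + (h *: u + z)).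
  move=> /andP[s0 s1]; rewrite -ball_normE /= addrA opprD addrCA subrr addr0 normrN.
  rewrite (le_lt_trans (ler_normD _ _))// !normrZ.
  rewrite (ger0_norm s0).
  apply: (@le_lt_trans _ _ (`|h| * (`|u| + `|v| + 1))); last by rewrite -ltr_pdivlMr.
  have : s * `|h| * `|v| <= `|h| * `|v|.
    by rewrite ler_wpM2r// ler_piMl.
  have := normr_ge0 h; lra.
pose g (s : R) := F ((s * h) *: v + (h *: u + z)).
have dg (s : R) : 0 <= s <= 1 ->
    is_derive s 1 g (h * 'D_v F ((s * h) *: v + (h *: u + z))).
  move=> s01; have [/= dF _] := dP _ (inb _ s01).
  have : is_derive (s *: (h *: v) + (h *: u + z)) (h *: v) F
      (h * 'D_v F ((s * h) *: v + (h *: u + z))).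
    by rewrite scalerA; apply/is_derive_scale_dir/derivableP.
  move=> /(@is_derive_line _ _ F (h *: u + z) (h *: v) _ s).
  by under eq_fun do rewrite scalerA.
have [c /= c01 gE] : exists2 c, c \in `[0, 1]%R &
    g 1 - g 0 = h * 'D_v F ((c * h) *: v + (h *: u + z)).
  pose dg1 (s : R) := h * 'D_v F ((s * h) *: v + (h *: u + z)).
  have [||c c01 ->] := @MVT_segment R g dg1 0 1 ler01.
  - by move=> x; rewrite in_itv /= => /andP[x0 x1]; apply: dg; rewrite !ltW.
  - apply: derivable_within_continuous => x; rewrite in_itv /= => x01.
    by case: (dg x x01).
  - by exists c; rewrite // subr0 mulr1.
have [_ /=] := dP _ (inb c c01).
move: gE; rewrite /g mul1r mul0r scale0r add0r => ->.
by rewrite [_^-1 *: _]mulrA mulVf// mul1r.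
Unshelve. all: by end_near. Qed.

(** [C1_on] controls coordinate directions only; their combinations are reached by adding one
    direction at a time with [is_deriveD_dir]. *)
Lemma is_derive_lincomb {R : realType} {V : normedModType R} (F : V -> R) z
    (m : nat) (e : 'I_m -> V) (c : 'I_m -> R) :
  (forall k, (\forall y \near z, derivable F y (e k)) /\
             {for z, continuous ('D_(e k) F)}) ->
  is_derive z (\sum_k c k *: e k) F (\sum_k c k * 'D_(e k) F z).
Proof.
move=> eF; elim/big_rec2: _ => [|k a v _ IH]; first exact: is_derive0.
have [dF cF] := eF k.
have Zd y : derivable F y (e k) -> 'D_(c k *: e k) F y = c k * 'D_(e k) F y.
  by move=> /derivableP /(is_derive_scale_dir (c k)) [].
have nZ : \forall y \near z, 'D_(c k *: e k) F y = c k * 'D_(e k) F y.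
  by apply: filterS dF => y; exact: Zd.
rewrite addrC [X in is_derive _ _ _ X]addrC -(nbhs_singleton nZ).
apply: (@is_deriveD_dir _ _ F z v (c k *: e k) a IH).
  apply: filterS dF => y dy.
  by case: (is_derive_scale_dir (c k) (derivableP dy)).
rewrite /prop_for /continuous_at (nbhs_singleton nZ).
apply: cvg_trans (cvgM (cvg_cst (c k)) cF).
by apply: near_eq_cvg; apply: filterS nZ => y ->.
Qed.

(** Fermat's rule gives [g1 0 = 0]. If [q] were positive, [g1] would be positive just to the right
    of 0, and the mean value theorem would push [g] above [g 0]. *)
Lemma second_derivative_test {R : realType} (g g1 : R -> R) (q : R) :
  (\forall h \near (0 : R), is_derive (h : R) 1 g (g1 h)) -> is_derive (0 : R) 1 g1 q ->
  (\forall h \near (0 : R), g h <= g 0) -> g1 0 = 0 /\ q <= 0.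
Proof.
move=> dg dg1 gmax.
have /nbhs_ballP[d /= d0 dP] : \forall h \near (0 : R),
  is_derive (h : R) 1 g (g1 h) /\ g h <= g 0 by exact: filterI.
have inb (x : R) : x \in `]-d, d[ -> ball (0 : R) d x.
  by rewrite in_itv /= -ltr_norml -ball_normE /= sub0r normrN.
have g10 : g1 0 = 0.
  have dg0 : is_derive (0 : R) 1 g 0.
    apply: (@derive1_at_max _ g (- d) d) => [|x xd||x xd].
    - lra.
    - by have [[]] := dP x (inb x xd).
    - by rewrite in_itv /= d0 oppr_lt0 d0.
    - by have [] := dP x (inb x xd).
  have d0d : 0 \in `]-d, d[ by rewrite in_itv /= d0 oppr_lt0 d0.
  have [[_ <-] _] := dP 0 (inb 0 d0d).
  by case: dg0.
split=> //; rewrite leNgt; apply/negP => q0.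
have /is_derive_cvg /cvgrPdist_lt /(_ _ q0) := dg1.
rewrite near_withinE => /nbhs_ballP[r /= r0 rP].
have g1_gt0 x : 0 < x -> x < r -> 0 < g1 x.
  move=> x0 xr; have := rP x; rewrite -ball_normE /= sub0r normrN gtr0_norm//.
  move=> /(_ xr (lt0r_neq0 x0)); rewrite [x%:A]mulr1 addr0 g10 subr0.
  move=> /ltr_distlBl; rewrite subrr.
  by rewrite [_^-1 *: _]mulrC; rewrite pmulr_lgt0// invr_gt0.
pose b := Num.min d r / 2.
have [b0 bd br] : [/\ 0 < b, b < d & b < r].
  rewrite /b; have : Num.min d r <= d by rewrite ge_min lexx.
  have : Num.min d r <= r by rewrite ge_min lexx orbT.
  have : 0 < Num.min d r by rewrite lt_min d0 r0.
  by split; lra.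
have bP x : x \in `[0, b] -> x \in `]- d, d[.
  by rewrite !in_itv /= => /andP[x0 xb]; apply/andP; split; lra.
have [||c] := @MVT R g g1 0 b b0.
- move=> x; rewrite in_itv /= => /andP[x0 xb].
  by have [] := dP x (inb x _); rewrite // bP// in_itv /= !ltW.
- apply: derivable_within_continuous => x xb.
  by have [[]] := dP x (inb x (bP x xb)).
rewrite in_itv /= => /andP[c0 cb] gb.
have b0b : b \in `[0, b] by rewrite in_itv /= lexx ltW.
have [_ gb0] := dP b (inb b (bP b b0b)).
suff : 0 < g1 c * (b - 0) by lra.
by rewrite subr0 mulr_gt0// g1_gt0// (lt_trans cb).
Qed.

(** * Test functions touching from above *)

Section test_functions.
Context {R : realType} {n : nat}.
Local Notation ST := (spacetime R n).
Implicit Types (Omega : set ST) (psi phi : ST -> R) (z : ST).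

Lemma near_line (A : set ST) (u z : ST) : nbhs z A ->
  \forall h \near (0 : R), A (h *: u + z).
Proof.
have hu : h *: u + z @[h --> (0 : R)] --> z.
  rewrite -[X in _ --> X]add0r -[X in _ --> X + _](scale0r u).
  by apply: cvgD; [exact: scalel_continuous|exact: cvg_cst].
by move=> /hu.
Qed.

Lemma C1_is_derive Omega psi z (m : nat) (e : 'I_m -> option 'I_n)
    (c : 'I_m -> R) : open Omega -> C1_on Omega psi -> Omega z ->
  is_derive z (\sum_k c k *: dir (e k) : ST) psi
    (\sum_k c k * pderiv (e k) psi z).
Proof.
move=> oO C1 Oz; apply: is_derive_lincomb => k; split; last by case: (C1 (e k) z Oz).
by apply: filterS (open_nbhs_nbhs (conj oO Oz)) => y /(C1 (e k))[].
Qed.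

Lemma C2_line Omega psi z (m : nat) (e : 'I_m -> option 'I_n) (c : 'I_m -> R)
    (u := (\sum_k c k *: dir (e k) : ST))
    (g1 := fun h : R => \sum_k c k * pderiv (e k) psi (h *: u + z)) :
  open Omega -> C2_on Omega psi -> Omega z ->
  (\forall h \near (0 : R), is_derive (h : R) 1 (fun s => psi (s *: u + z)) (g1 h))
  /\ is_derive (0 : R) 1 g1
       (\sum_k c k * \sum_l c l * pderiv (e l) (pderiv (e k) psi) z).
Proof.
move=> oO [C1 C2] Oz; split.
  apply: filterS (near_line u (open_nbhs_nbhs (conj oO Oz))) => h Oh.
  by apply: is_derive_line; exact: C1_is_derive Oh.
rewrite /g1 (_ : (fun h => _) = \sum_k
    (c k \*: (fun h : R => pderiv (e k) psi (h *: u + z)))); last first.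
  by apply/funext => h; rewrite fct_sumE.
apply: is_derive_sum => k; apply: is_deriveZ; apply: is_derive_line.
by rewrite scale0r add0r; exact: C1_is_derive (C2 (e k)) Oz.
Qed.

(** The second derivative test is applied to [phi - psi] along a line through [z]. Leaving the
    family [e] free serves twice: a single direction compares first partials, and the [n] spatial
    directions compare Hessians. *)
Lemma max_second_order Omega phi psi z (m : nat) (e : 'I_m -> option 'I_n)
    (c : 'I_m -> R) :
  open Omega -> C2_on Omega phi -> C2_on Omega psi -> Omega z ->
  (\forall y \near z, phi y - psi y <= phi z - psi z) ->
  \sum_k c k * pderiv (e k) phi z = \sum_k c k * pderiv (e k) psi z /\
  \sum_k c k * \sum_l c l * pderiv (e l) (pderiv (e k) phi) z <=
  \sum_k c k * \sum_l c l * pderiv (e l) (pderiv (e k) psi) z.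
Proof.
move=> oO C2phi C2psi Oz zmax; set u := (\sum_k c k *: dir (e k) : ST).
have [dphi ddphi] := C2_line e c oO C2phi Oz.
have [dpsi ddpsi] := C2_line e c oO C2psi Oz.
have ddB := is_deriveB ddphi ddpsi.
have [||] := second_derivative_test
  (g := (fun s => phi (s *: u + z)) - (fun s => psi (s *: u + z))) _ ddB.
- move: dphi dpsi; apply: filterS2 => h dphi dpsi; exact: (is_deriveB dphi dpsi).
- have := near_line u zmax; apply: filterS => h.
  by rewrite !fctE scale0r add0r.
by rewrite !fctE scale0r add0r subr_le0 => /eqP; rewrite subr_eq0 => /eqP.
Qed.

Lemma max_pderiv Omega phi psi z k :
  open Omega -> C2_on Omega phi -> C2_on Omega psi -> Omega z ->
  (\forall y \near z, phi y - psi y <= phi z - psi z) ->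
  pderiv k phi z = pderiv k psi z.
Proof.
move=> oO C2phi C2psi Oz zmax.
have [+ _] := max_second_order (fun=> k) (fun _ : 'I_1 => 1) oO C2phi C2psi Oz zmax.
by rewrite !big_ord1 !mul1r.
Qed.

(** * Quadratic forms and the largest eigenvalue *)

Definition quadratic_form (X : 'M[R]_n) (c : 'I_n -> R) : R :=
  \sum_i \sum_j c i * c j * X i j.

Lemma max_hessian Omega phi psi z (c : 'I_n -> R) :
  open Omega -> C2_on Omega phi -> C2_on Omega psi -> Omega z ->
  (\forall y \near z, phi y - psi y <= phi z - psi z) ->
  quadratic_form (hessian phi z) c <= quadratic_form (hessian psi z) c.
Proof.
move=> oO C2phi C2psi Oz zmax.
have E psi' : quadratic_form (hessian psi' z) c =
    \sum_k c k * \sum_l c l * pderiv (Some l) (pderiv (Some k) psi') z.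
  apply: eq_bigr => i _; rewrite mulr_sumr; apply: eq_bigr => j _.
  by rewrite mxE mulrA.
by rewrite !E; have [] := max_second_order some c oO C2phi C2psi Oz zmax.
Qed.

(** Pairing the eigenvector equation with the eigenvector itself: its Rayleigh quotient is the
    eigenvalue. *)
Lemma eigenvalue_quadratic_form (X : 'M[R]_n) a : eigenvalue X a ->
  exists2 c : 'I_n -> R, 0 < \sum_i c i ^+ 2 &
    quadratic_form X c = a * \sum_i c i ^+ 2.
Proof.
move=> /eigenvalueP[v vX v0]; exists (v 0).
  rewrite lt_def sumr_ge0 ?andbT => [|i _]; last exact: sqr_ge0.
  apply: contraNN v0 => /eqP s0; apply/eqP/rowP => i; rewrite mxE.
  by apply/eqP; rewrite -sqrf_eq0; apply/eqP;
    apply: (psumr_eq0P _ s0) => // j _; exact: sqr_ge0.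
rewrite /quadratic_form exchange_big mulr_sumr; apply: eq_bigr => j _.
have := congr1 (fun w : 'rV_n => w 0 j) vX; rewrite !mxE => vXj.
rewrite expr2 mulrA -vXj mulr_suml; apply: eq_bigr => i _; ring.
Qed.

(* [sup] is [0] on empty or unbounded sets, whence the sign conditions. *)
Lemma largest_eigenvalue_ge (X : 'M[R]_n) b : b <= 0 ->
  (forall c, b * \sum_i c i ^+ 2 <= quadratic_form X c) ->
  b <= largest_eigenvalue X.
Proof.
move=> b0 bX; rewrite /largest_eigenvalue; set E := [set _ | _].
have [supE|nsup] := pselect (has_sup E); last by rewrite sup_out.
have [[a Ea] ubE] := supE; apply: le_trans (ub_le_sup ubE Ea).
have [c c0 qc] := eigenvalue_quadratic_form Ea.
by rewrite -(ler_pM2r c0) -qc.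
Qed.

Lemma largest_eigenvalue_le (X : 'M[R]_n) b : 0 <= b ->
  (forall c, quadratic_form X c <= b * \sum_i c i ^+ 2) ->
  largest_eigenvalue X <= b.
Proof.
move=> b0 bX; rewrite /largest_eigenvalue; set E := [set _ | _].
have [[E0 _]|nsup] := pselect (has_sup E); last by rewrite sup_out.
apply: sup_le_ub => // a Ea.
have [c c0 qc] := eigenvalue_quadratic_form Ea.
by rewrite -(ler_pM2r c0) -qc.
Qed.

End test_functions.

(** * The Gaussian barrier *)

Section barrier.
Context {R : realType} {n : nat}.
Local Notation ST := (spacetime R n).
Implicit Types (z zc : ST) (k l : option 'I_n).

(** Indexing by the same type as [dir] lets space and time share every derivative formula. *)
Definition coord k z : R := if k is Some i then z.1 0 i else z.2.

Lemma coord_linear k (h : R) z zc :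
  coord k (h *: z + zc) = h * coord k z + coord k zc.
Proof. by case: k => [i|] //=; rewrite !mxE. Qed.

Lemma coord_dir k l : coord k (dir l : ST) = (k == l)%:R.
Proof. by case: k l => [i|] [j|] //=; rewrite mxE //= eq_sym. Qed.

Lemma is_derive_coord k l z :
  is_derive z (dir l : ST) (coord k) ((k == l)%:R : R).
Proof.
apply: cvg_is_derive.
apply: cvg_trans (@cvg_cst R ((k == l)%:R : R) R 0^' _).
apply: near_eq_cvg.
near=> h; rewrite coord_linear coord_dir addrK [RHS]mulrA mulVf ?mul1r//.
by near: h; exact: nbhs_dnbhs_neq.
Unshelve. all: by end_near. Qed.

Lemma coord_continuous k : continuous (coord k : ST -> R).
Proof.
case: k => [i|] z /=; last exact: cvg_snd.
apply: (@continuous_comp _ _ _ (fst : ST -> 'rV[R]_n) (fun x => x 0 i)).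
  exact: cvg_fst.
exact: coord_continuous.
Qed.

Lemma sqdistE z zc : sqdist z zc =
  \sum_(i < n) (coord (Some i) z - coord (Some i) zc) ^+ 2 +
  (coord None z - coord None zc) ^+ 2.
Proof. by []. Qed.

Lemma sqdist_continuous zc : continuous (fun z => sqdist z zc).
Proof.
have sq k : continuous (fun z => (coord k z - coord k zc) ^+ 2).
  move=> z; under eq_fun do rewrite expr2.
  have cB : {for z, continuous (fun z => coord k z - coord k zc)}.
    by apply: cvgB; [exact: coord_continuous|exact: cvg_cst].
  exact: cvgM.
move=> z; apply: cvgD; last exact: (sq None).
by apply: continuous_big => [|i _]; [exact: add_continuous|exact: (sq (Some i))].
Qed.

Lemma is_derive_sqdist zc l z :
  is_derive z (dir l : ST) (fun z => sqdist z zc) (2 * (coord l z - coord l zc)).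
Proof.
pose f k : ST -> R := coord k - cst (coord k zc).
have df k : is_derive z (dir l : ST) (f k) ((k == l)%:R).
  by rewrite -[_%:R]subr0; apply: is_deriveB; exact: is_derive_coord.
have df2 k : is_derive z (dir l : ST) (f k ^+ 2)
    (2 * (k == l)%:R * (coord k z - coord k zc)).
  apply: (is_derive_eq (is_deriveX 2 (df k))).
  by rewrite /f !fctE /= expr1 [LHS]mulrAC.
rewrite (_ : (fun z => _) = \sum_i (f (Some i) ^+ 2) + f None ^+ 2); last first.
  by apply/funext => y; rewrite sqdistE fctE fct_sumE.
apply: (is_derive_eq (is_deriveD (is_derive_sum (fun i => df2 (Some i))) (df2 None))).
case: l {df df2} => [j|]; last first.
  by rewrite big1 ?add0r ?mulr1// => i _; rewrite mulr0 mul0r.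
rewrite (bigD1 j)//= eqxx mulr1 mulr0 mul0r addr0 big1 ?addr0// => i ij.
by rewrite (inj_eq Some_inj) (negbTE ij) mulr0 mul0r.
Qed.

Definition gauss (al : R) zc z : R := expR (- al * sqdist z zc).

Lemma gauss_gt0 al zc z : 0 < gauss al zc z.
Proof. exact: expR_gt0. Qed.

Lemma gauss_continuous al zc : continuous (gauss al zc).
Proof.
move=> z; apply: (@continuous_comp _ _ _ (fun z => - al * sqdist z zc) expR).
  by apply: cvgM; [exact: cvg_cst|exact: sqdist_continuous].
exact: continuous_expR.
Qed.

Lemma is_derive_gauss al zc l z :
  is_derive z (dir l : ST) (gauss al zc)
    (- (2 * al) * (coord l z - coord l zc) * gauss al zc z).
Proof.
apply: line_is_derive.
have d1 : is_derive (0 : R) 1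
    (fun s : R => (- al \*: (fun z => sqdist z zc)) (s *: (dir l : ST) + z))
    (- al * (2 * (coord l z - coord l zc))).
  apply: is_derive_line; rewrite scale0r add0r.
  apply: is_deriveZ; exact: is_derive_sqdist.
have := is_derive1_comp (is_derive_expR _) d1.
by rewrite scale0r add0r => h; apply: (is_derive_eq h); rewrite /gauss /=;
  rewrite [_ *: _]/(_ * _) mulrC; congr (_ * _); ring.
Qed.

(** One family for all comparison functions: [K < 0] gives barriers from above, [K > 0] barriers
    from below, and [K = 0] constants. *)
Definition barrier (c K al : R) zc z : R := c + K * gauss al zc z.

Lemma barrier_continuous c K al zc : continuous (barrier c K al zc).
Proof.
move=> z; apply: cvgD; first exact: cvg_cst.
by apply: cvgM; [exact: cvg_cst|exact: gauss_continuous].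
Qed.

Let dbarrier K al zc k z :=
  - (2 * al * K) * ((coord k z - coord k zc) * gauss al zc z).

Let is_derive_barrier c K al zc k z :
  is_derive z (dir k : ST) (barrier c K al zc) (dbarrier K al zc k z).
Proof.
rewrite (_ : barrier c K al zc = cst c + K \*: gauss al zc); last exact/funext.
apply: (is_derive_eq (is_deriveD (is_derive_cst _ _ _)
  (is_deriveZ K (is_derive_gauss al zc k z)))).
by rewrite add0r [LHS]mulrC /dbarrier; ring.
Qed.

Let is_derive_dbarrier K al zc k l z :
  is_derive z (dir l : ST) (dbarrier K al zc k)
    (- (2 * al * K) * (((k == l)%:R - 2 * al * (coord k z - coord k zc)
        * (coord l z - coord l zc)) * gauss al zc z)).
Proof.
rewrite (_ : dbarrier K al zc k = - (2 * al * K) \*: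
  ((coord k - cst (coord k zc)) * gauss al zc)); last exact/funext.
apply: (is_derive_eq (is_deriveZ _ (is_deriveM
  (is_deriveB (is_derive_coord k l z) (is_derive_cst _ _ _))
  (is_derive_gauss al zc l z)))).
rewrite !fctE subr0.
transitivity (- (2 * al * K) * ((coord k z - coord k zc) *
  (- (2 * al) * (coord l z - coord l zc) * gauss al zc z) +
  gauss al zc z * (k == l)%:R)) => //.
ring.
Qed.

Lemma pderiv_barrier c K al zc k : pderiv k (barrier c K al zc) =
  fun z => - (2 * al * K) * ((coord k z - coord k zc) * gauss al zc z).
Proof. by apply/funext => z; case: (is_derive_barrier c K al zc k z). Qed.

Lemma pderiv_pderiv_barrier c K al zc k l :
  pderiv l (pderiv k (barrier c K al zc)) =
  fun z => - (2 * al * K) * (((k == l)%:R - 2 * al * (coord k z - coord k zc)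
        * (coord l z - coord l zc)) * gauss al zc z).
Proof.
rewrite pderiv_barrier; apply/funext => z.
by case: (is_derive_dbarrier K al zc k l z).
Qed.

Lemma barrier_C2 (Omega : set ST) c K al zc : C2_on Omega (barrier c K al zc).
Proof.
have ck k z : {for z, continuous (fun z => coord k z - coord k zc)}.
  by apply: cvgB; [exact: coord_continuous|exact: cvg_cst].
split=> [k z _|k l z _].
  split; first by case: (is_derive_barrier c K al zc k z).
  rewrite pderiv_barrier; apply: cvgM; first exact: cvg_cst.
  by apply: cvgM; [exact: ck|exact: gauss_continuous].
rewrite pderiv_pderiv_barrier; split.
  by rewrite pderiv_barrier; case: (is_derive_dbarrier K al zc k l z).
apply: cvgM; first exact: cvg_cst.
apply: cvgM; last exact: gauss_continuous.
apply: cvgB; first exact: cvg_cst.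
apply: cvgM; last exact: ck.
by apply: cvgM; [exact: cvg_cst|exact: ck].
Qed.

End barrier.

(** * Supersolution and subsolution properties of the barrier *)

Section barrier_test.
Context {R : realType} {n : nat}.
Local Notation ST := (spacetime R n).
Variables (c K al : R) (zc z : ST).
Let phi := barrier c K al zc.
(** Common factor of the derivatives at [z]: with y = x - x', the spatial gradient is A y and the
    time derivative [A * tau]. For [0 < al] its sign is opposite to that of [K]. *)
Let A := - (2 * al * K) * gauss al zc z.
Let s := \sum_(i < n) (coord (Some i) z - coord (Some i) zc) ^+ 2.
Let tau := coord None z - coord None zc.

Let Dt_barrier : Dt phi z = A * tau.
Proof. by rewrite /Dt /phi pderiv_barrier /A /tau; ring. Qed.

Let grad_barrier i : grad phi z 0 i = A * (coord (Some i) z - coord (Some i) zc).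
Proof. by rewrite mxE /phi pderiv_barrier /A; ring. Qed.

Let sqr_grad_barrier : \sum_(i < n) grad phi z 0 i ^+ 2 = A ^+ 2 * s.
Proof. by rewrite mulr_sumr; apply: eq_bigr => i _; rewrite grad_barrier exprMn. Qed.

(** In matrix form, the Hessian is A (I - 2 al y y^T) with y = x - x'. *)
Let quadratic_form_barrier d : quadratic_form (hessian phi z) d =
  A * (\sum_i d i ^+ 2 -
       2 * al * (\sum_i d i * (coord (Some i) z - coord (Some i) zc)) ^+ 2).
Proof.
pose y i := coord (Some i) z - coord (Some i) zc.
transitivity (\sum_i (A * d i ^+ 2 - 2 * al * A * (d i * y i) * \sum_j d j * y j)).
  apply: eq_bigr => i _.
  transitivity (\sum_j (A * d i * (d j * (i == j)%:R) -
                        2 * al * A * (d i * y i) * (d j * y j))).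
    apply: eq_bigr => j _; rewrite mxE /phi pderiv_pderiv_barrier.
    by rewrite (inj_eq Some_inj) /A /y; ring.
  rewrite sumrB -!mulr_sumr; congr (_ - _); rewrite expr2 mulrA; congr (_ * _).
  rewrite (bigD1 i)//= eqxx mulr1 big1 ?addr0// => j ij.
  by rewrite eq_sym (negbTE ij) mulr0.
by rewrite sumrB -!mulr_suml -!mulr_sumr; ring.
Qed.

Let s_ge0 : 0 <= s.
Proof. by apply: sumr_ge0 => i _; exact: sqr_ge0. Qed.

Let grad_barrier_neq0 : grad phi z != 0 -> A != 0 /\ s != 0.
Proof.
move=> g0; suff : A ^+ 2 * s != 0 by rewrite mulf_eq0 sqrf_eq0 negb_or => /andP[].
apply: contraNN g0 => /eqP; rewrite -sqr_grad_barrier => g0.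
apply/eqP/rowP => i; rewrite [RHS]mxE; apply/eqP; rewrite -sqrf_eq0; apply/eqP.
have sq_ge0 (j : 'I_n) : true -> 0 <= grad phi z 0 j ^+ 2 by rewrite sqr_ge0.
exact: (psumr_eq0P sq_ge0 g0).
Qed.

(** The gradient is parallel to y, which is an eigenvector of I - 2 al y y^T for 1 - 2 al |y|^2. *)
Let norm_inf_laplacian_barrier : grad phi z != 0 ->
  norm_inf_laplacian phi z = A * (1 - 2 * al * s).
Proof.
move=> /grad_barrier_neq0[A0 s0].
rewrite /norm_inf_laplacian -/(quadratic_form (hessian phi z) (grad phi z 0)).
rewrite quadratic_form_barrier sqr_grad_barrier.
have -> : \sum_i grad phi z 0 i * (coord (Some i) z - coord (Some i) zc) = A * s.
  by rewrite mulr_sumr; apply: eq_bigr => i _; rewrite grad_barrier -mulrA.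
by field; rewrite s0 A0.
Qed.

Let grad_barrier_eq0 : grad phi z = 0 -> A != 0 -> s = 0.
Proof.
move=> g0 A0; have := sqr_grad_barrier.
rewrite g0 big1 => [|i _]; last by rewrite mxE expr0n.
by move=> /esym/eqP; rewrite mulf_eq0 sqrf_eq0 (negbTE A0) => /eqP.
Qed.

(* Large [al] makes this hold away from the axis [x = x']; on the axis it reads
   [1 < t - t']. *)
Definition barrier_condition := 1 < tau + 2 * al * s.

(** Here [A] is positive. Where the gradient is nonzero, the difference equals A (tau + 2 al s - 1).
    Where it vanishes, [s] is 0, the Hessian is at most A I, and the condition reads 1 < tau. *)
Lemma barrier_strict_supersolution : 0 < al -> K < 0 -> barrier_condition ->
  (grad phi z != 0 -> 0 < Dt phi z - norm_inf_laplacian phi z) /\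
  (grad phi z = 0 -> 0 < Dt phi z - largest_eigenvalue (hessian phi z)).
Proof.
move=> al0 K0 good.
have A0 : 0 < A.
  by rewrite /A mulr_gt0 ?gauss_gt0// -mulrN mulr_gt0 ?mulr_gt0 ?oppr_gt0.
split=> [gn0|g0].
  rewrite norm_inf_laplacian_barrier// Dt_barrier -mulrBr mulr_gt0//.
  by move: good; rewrite /barrier_condition; lra.
have sE := grad_barrier_eq0 g0 (lt0r_neq0 A0).
rewrite subr_gt0 Dt_barrier; apply: (@le_lt_trans _ _ A).
  apply: largest_eigenvalue_le => [|d]; first exact: ltW.
  rewrite quadratic_form_barrier ler_pM2l// lerBlDr lerDl.
  by rewrite mulr_ge0 ?sqr_ge0// mulr_ge0// ltW.
by rewrite ltr_pMr//; move: good; rewrite /barrier_condition sE mulr0 addr0.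
Qed.

(** At the contact point the first derivatives agree and the Hessian of [psi] dominates that of the
    barrier, so the subsolution inequality of the barrier, which holds because now [A <= 0], passes
    to [psi]. For [K = 0] the barrier is constant and the inequality is trivial. *)
Lemma barrier_touching_from_below (Omega : set ST) psi :
  open Omega -> Omega z -> C2_on Omega psi ->
  (\forall y \near z, phi y - psi y <= phi z - psi z) ->
  0 < al -> 0 <= K -> (K != 0 -> barrier_condition) ->
  (grad psi z != 0 -> Dt psi z - norm_inf_laplacian psi z <= 0) /\
  (grad psi z = 0 -> Dt psi z - largest_eigenvalue (hessian psi z) <= 0).
Proof.
move=> oO Oz C2psi zmax al0 K0 good.
have C2phi : C2_on Omega phi by exact: barrier_C2.
have dE k : pderiv k psi z = pderiv k phi z.
  by apply/esym/max_pderiv; [exact: oO|..].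
have gradE : grad psi z = grad phi z by apply/rowP => i; rewrite !mxE dE.
have DtE : Dt psi z = A * tau by rewrite /Dt dE; exact: Dt_barrier.
have QE d : quadratic_form (hessian phi z) d <= quadratic_form (hessian psi z) d.
  by apply: max_hessian; [exact: oO|..].
have A0 : A <= 0.
  by rewrite /A mulNr oppr_le0 !mulr_ge0 ?(ltW (gauss_gt0 _ _ _))// ltW.
have good' : A != 0 -> barrier_condition.
  move=> An0; apply: good; apply: contraNN An0 => /eqP K00.
  by rewrite /A K00 mulr0 oppr0 mul0r.
rewrite gradE; split=> [gn0|g0].
  have [An0 sn0] := grad_barrier_neq0 gn0.
  (* Equal gradients give the same weight and the same direction, so only the Hessian quadratic
     forms have to be compared. *)
  have lapE : norm_inf_laplacian phi z <= norm_inf_laplacian psi z.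
    rewrite /norm_inf_laplacian gradE ler_wpM2l ?QE// invr_ge0.
    by apply: sumr_ge0 => i _; exact: sqr_ge0.
  rewrite norm_inf_laplacian_barrier// in lapE.
  rewrite subr_le0 DtE; apply: (@le_trans _ _ (A * (1 - 2 * al * s))); last exact: lapE.
  rewrite ler_wnM2l//; have := good' An0; rewrite /barrier_condition; lra.
(* The value [A] separates both sides: either [A = 0], or z lies on the axis, where 1 < tau and the
   Hessian of the barrier is A I. *)
rewrite subr_le0 DtE; apply: (@le_trans _ _ A).
  have [->|An0] := eqVneq A 0; first by rewrite mul0r.
  have := good' An0; rewrite /barrier_condition (grad_barrier_eq0 g0 An0).
  by rewrite mulr0 addr0 => tau1; rewrite -[leRHS]mulr1 ler_wnM2l// ltW.
apply: largest_eigenvalue_ge => // d; apply: le_trans (QE d).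
rewrite quadratic_form_barrier.
have [->|An0] := eqVneq A 0; first by rewrite !mul0r.
suff -> : \sum_i d i * (coord (Some i) z - coord (Some i) zc) = 0.
  by rewrite expr0n mulr0 subr0.
have /psumr_eq0P y0 := grad_barrier_eq0 g0 An0.
apply: big1 => i _; have /eqP := y0 (fun i _ => sqr_ge0 _) i isT.
by rewrite sqrf_eq0 => /eqP ->; rewrite mulr0.
Qed.

End barrier_test.

(** * Contact points of semicontinuous functions *)

(** The sets where [g] is at least [g a] are nested, so they generate a proper filter on [A]. A
    cluster point [p] is a maximiser: if [g p < g a], semicontinuity would separate [p] from the set
    of level [g a]. *)
Lemma usc_compact_max {R : realType} {T : topologicalType} (A : set T) (g : T -> R) :
  compact A -> A !=set0 ->
  (forall p, A p -> forall a : R, g p < a ->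
    \forall y \near within A (nbhs p), g y < a) ->
  exists2 p, A p & forall z, A z -> g z <= g p.
Proof.
move=> cA [a0 Aa0] gusc.
pose F := filter_from A (fun a => [set z | A z /\ g a <= g z]).
have FF : ProperFilter F.
  apply: filter_from_proper => [|a Aa]; last by exists a; split.
  apply: filter_from_filter; first by exists a0.
  move=> a b Aa Ab; have [ab|/ltW ba] := leP (g a) (g b).
    by exists b => // z [Az bz]; split; split=> //; exact: le_trans bz.
  by exists a => // z [Az az]; split; split=> //; exact: le_trans az.
have [|p [Ap clp]] := cA F FF; first by exists a0 => // z [].
exists p => // a Aa; rewrite leNgt; apply/negP => pa.
have Fa : F [set z | A z /\ g a <= g z] by exists a.
have [y [[Ay ay] /(_ Ay)]] := clp _ _ Fa (gusc p Ap _ pa).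
by rewrite ltNge ay.
Qed.

Section comparison.
Context {R : realType} {n : nat}.
Local Notation ST := (spacetime R n).
Implicit Types (Omega : set ST) (phi : ST -> R) (z : ST).

(** [Omega] lies in a product of two compact closed balls, one of row vectors and one of reals. *)
Lemma bounded_compact_closure Omega : bounded_set Omega -> compact (closure Omega).
Proof.
move=> /pinfty_ex_gt0[M M0 OM].
pose P := [set x : 'rV[R]_n | `|x| <= M].
pose Q := [set x : R | `|x| <= M].
have clb (V : normedModType R) : closed [set x : V | `|x| <= M].
  exact: ((continuous_closedP _).1 (@norm_continuous _ V) _ (@closed_le R M)).
have cP : compact P.
  apply: bounded_closed_compact; last exact: clb.
  exists M; split; first exact: num_real.
  by move=> r Mr x; rewrite /P /= => /le_trans; apply; exact: ltW.
have cQ : compact Q.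
  rewrite (_ : Q = [set` `[- M, M]]); first exact: segment_compact.
  by apply/seteqP; split=> x; rewrite /Q /= in_itv /= ler_norml.
have OPQ : Omega `<=` P `*` Q.
  move=> z /OM zM; split; rewrite /P /Q /=; apply: le_trans zM.
    by rewrite [leRHS]prod_normE le_max lexx.
  by rewrite [leRHS]prod_normE le_max lexx orbT.
apply: (subclosed_compact _ (compact_setX cP cQ)); first exact: closed_closure.
apply: (subset_trans (closureS OPQ)).
have /closure_id <- // : closed (P `*` Q).
exact: compact_closed (compact_setX cP cQ).
Qed.

(** The set where [u - phi] is at least its positive value [s] at [z0] stays away from the boundary,
    because there the upper limit of [u] is at most [phi]. Hence it is compact, and [u] is
    real-valued on it. *)
Lemma touching_point Omega (u : ST -> \bar R) phi z0 :
  open Omega -> compact (closure Omega) ->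
  (forall z, Omega z -> u z != +oo%E) -> usc_on Omega u ->
  (forall z, boundary Omega z ->
    (limf_esup u (within Omega (nbhs z)) <= (phi z)%:E)%E) ->
  continuous phi -> Omega z0 -> ((phi z0)%:E < u z0)%E ->
  exists z, [/\ Omega z, ((phi z)%:E < u z)%E &
    max_at Omega (fun z => u z - (phi z)%:E)%E z].
Proof.
move=> oO cO ufin uusc ubd cphi Oz0 u0.
have uE z a : Omega z -> (a%:E <= u z)%E -> u z = (fine (u z))%:E.
  move=> Oz az; rewrite fineK// fin_numE ufin// andbT.
  by apply: contraTneq az => ->; rewrite leeNy_eq.
have u0E := uE _ _ Oz0 (ltW u0).
pose g z := fine (u z) - phi z.
have s0 : 0 < g z0 by move: u0; rewrite u0E lte_fin subr_gt0.
set s := g z0 in s0.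
pose A := [set z | Omega z /\ ((phi z + s)%:E <= u z)%E].
have nearlt z (a t : R) : a < phi z + t ->
    (\forall y \near within Omega (nbhs z), (u y < a%:E)%E) ->
    \forall y \near within Omega (nbhs z), (u y < (phi y + t)%:E)%E.
  move=> at_ ua.
  have pa : \forall y \near z, a < phi y + t.
    have : phi y + t @[y --> z] --> phi z + t.
      by apply: cvgD; [exact: cphi|exact: cvg_cst].
    by move=> /cvgr_gt; apply.
  move: ua; rewrite !near_withinE; move: pa; apply: filterS2 => y ay uy Oy.
  by apply: (lt_trans (uy Oy)); rewrite lte_fin.
have usct z t : Omega z -> (u z < (phi z + t)%:E)%E ->
    \forall y \near within Omega (nbhs z), (u y < (phi y + t)%:E)%E.
  move=> Oz uzt.
  have [a ua at_] : exists2 a, (u z < a%:E)%E & a < phi z + t.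
    move: (ufin z Oz) uzt; case: (u z) => [r| |] // _.
      rewrite lte_fin => rt; exists ((r + (phi z + t)) / 2); rewrite ?lte_fin; lra.
    by move=> _; exists (phi z + t - 1); rewrite ?ltNyr//; lra.
  exact: nearlt at_ (uusc z Oz a ua).
have clA : closed A.
  move=> z clAz.
  have contra : ~ \forall y \near within Omega (nbhs z), (u y < (phi y + s)%:E)%E.
    move=> /clAz[y [[Oy sy] /(_ Oy)]].
    by rewrite ltNge sy.
  have clOz : closure Omega z by move: clAz; apply: closureS => y [].
  have [Oz|nOz] := pselect (Omega z).
    by split=> //; rewrite leNgt; apply/negP => /(usct _ _ Oz).
  exfalso; apply: contra.
  have bz : boundary Omega z by split=> //; rewrite ((interior_id _).1 oO).
  (* The level [s / 2] leaves room both above the upper limit of [u] and below [phi + s]. *)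
  apply: (@nearlt z (phi z + s / 2)); first by lra.
  have : (limf_esup u (within Omega (nbhs z)) < (phi z + s / 2)%:E)%E.
    by apply: (le_lt_trans (ubd z bz)); rewrite lte_fin; lra.
  move=> /ereal_inf_lt[_ [V FV <-]] Vlt.
  apply: filterS FV => y Vy; apply: le_lt_trans Vlt.
  by apply: ereal_sup_ubound; exists y.
have AsubO : A `<=` Omega by move=> z [].
have cA : compact A.
  by apply: subclosed_compact clA cO _ => z /AsubO; exact: subset_closure.
have Az0 : A z0 by split=> //; rewrite u0E lee_fin /s /g; lra.
have [||p Ap pmax] := usc_compact_max (g := g) cA; first by exists z0.
  move=> p [Op sp] a pa.
  have : (u p < (phi p + a)%:E)%E.
    by rewrite (uE _ _ Op sp) lte_fin; move: pa; rewrite /g; lra.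
  move=> /(usct _ _ Op); rewrite !near_withinE; apply: filterS => y uy [Oy sy].
  by move: (uy Oy); rewrite (uE _ _ Oy sy) lte_fin /g; lra.
have [Op sp] := Ap; have upE := uE _ _ Op sp.
have gp : s <= g p by exact: pmax.
exists p; split=> //; first by rewrite upE lte_fin; move: gp; rewrite /g; lra.
split=> // z Oz; rewrite upE -EFinB.
(* Outside [A] the difference is below [s], hence below its value at [p]. *)
have [sz|zs] := leP (phi z + s)%:E (u z).
  by rewrite (uE _ _ Oz sz) -EFinB lee_fin; apply: (pmax z).
rewrite leeBlDr// -EFinD (le_trans (ltW zs))// lee_fin.
by move: gp; rewrite /g; lra.
Qed.

End comparison.

(** * Barriers and the lower class *)

Section perron.
Context {R : realType} {n : nat}.
Local Notation ST := (spacetime R n).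
Implicit Types (Omega : set ST) (f : ST -> R) (z zeta zc : ST) (c K al : R).

(** If [v] exceeded the barrier, their contact point would make the barrier a test function for [v],
    against strictness. The disjunction lets a bound known beforehand replace the barrier condition
    far from the contact point of the ball. *)
Lemma lower_class_le_barrier Omega f (v : ST -> \bar R) c K al zc :
  open Omega -> compact (closure Omega) -> lower_class Omega f v ->
  0 < al -> K < 0 ->
  (forall zeta, boundary Omega zeta -> f zeta <= barrier c K al zc zeta) ->
  (forall z, Omega z -> (v z <= (barrier c K al zc z)%:E)%E \/
                        barrier_condition al zc z) ->
  forall z, Omega z -> (v z <= (barrier c K al zc z)%:E)%E.
Proof.
move=> oO cO [[vfin vusc vtest] vbd] al0 K0 fle vcond z Oz.
rewrite leNgt; apply/negP => zlt.
have [||y [Oy ylt ymax]] := touching_point oO cO vfin vusc _ _ Oz zlt.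
- move=> zeta bz; apply: (le_trans (vbd _ bz)); rewrite lee_fin; exact: fle.
- exact: barrier_continuous.
have [|good] := vcond y Oy; first by rewrite leNgt ylt.
have [h1 h2] := vtest _ _ (barrier_C2 Omega c K al zc) ymax.
have [s1 s2] := barrier_strict_supersolution c al0 K0 good.
have [g0|g0] := eqVneq (grad (barrier c K al zc) y) 0.
  by move: (h2 g0); rewrite leNgt s2.
by move: (h1 g0); rewrite leNgt s1.
Qed.

Lemma limf_esup_le_continuous (F : set_system ST) (h : ST -> R) zeta (a : R) :
  F --> zeta -> {for zeta, continuous h} -> h zeta <= a ->
  (limf_esup (EFin \o h) F <= a%:E)%E.
Proof.
move=> Fz ch ha; apply/lee_addgt0Pr => e e0.
have /Fz FV : \forall y \near zeta, h y < a + e.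
  by apply: (cvgr_lt (h zeta) ch); lra.
apply: (@le_trans _ _ (ereal_sup ((EFin \o h) @` [set y | h y < a + e]))).
  by apply: ereal_inf_lbound; exists [set y | h y < a + e].
by apply: ub_ereal_sup => _ [y /= hy <-]; rewrite -EFinD lee_fin ltW.
Qed.

(** A test function touching the maximum from above also touches the branch that attains it. The
    barrier condition therefore matters only where the barrier exceeds [m]. *)
Lemma max_barrier_lower_class Omega f c K al zc (m : R) :
  open Omega -> 0 < al -> 0 <= K ->
  (forall z, Omega z -> m < barrier c K al zc z -> barrier_condition al zc z) ->
  (forall zeta, boundary Omega zeta ->
    Num.max (barrier c K al zc zeta) m <= f zeta) ->
  lower_class Omega f (EFin \o (fun z => Num.max (barrier c K al zc z) m)).
Proof.
move=> oO al0 K0 cond fge; set h := fun z => Num.max _ m.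
have ch : continuous h.
  move=> z; apply: (@continuous_max _ _ (barrier c K al zc) (cst m)).
    exact: barrier_continuous.
  exact: cvg_cst.
split; last first.
  move=> zeta bz; apply: (limf_esup_le_continuous _ (ch zeta) (fge _ bz)).
  exact: cvg_within.
split=> [//|z Oz a|psi zeta C2psi [Oz zmax]].
  rewrite lte_fin => hza; apply: cvg_within.
  have hn : \forall y \near z, h y < a by apply: (cvgr_lt (h z) (ch z)).
  by apply: filterS hn => y; rewrite lte_fin.
have near_max (phi : ST -> R) : (forall y, phi y <= h y) -> phi zeta = h zeta ->
    \forall y \near zeta, phi y - psi y <= phi zeta - psi zeta.
  move=> phih phiz; apply: filterS (open_nbhs_nbhs (conj oO Oz)) => y Oy.
  have := zmax y Oy; rewrite /= -!EFinB lee_fin phiz; apply: le_trans.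
  by rewrite lerB.
have [mlt|mge] := ltP m (barrier c K al zc zeta).
  apply: (@barrier_touching_from_below _ _ c K al zc zeta Omega psi) => //.
    apply: near_max => [y|]; first by rewrite /h le_max lexx.
    by rewrite /h max_l// ltW.
  by move=> _; exact: cond.
(* The constant branch is the barrier with [K = 0]. *)
apply: (@barrier_touching_from_below _ _ m 0 al zc zeta Omega psi) => //.
  apply: near_max => [y|]; rewrite /barrier mul0r addr0.
    by rewrite /h le_max lexx orbT.
  by rewrite /h max_r.
by rewrite eqxx.
Qed.

End perron.

(** * The exterior ball *)

Section exterior_ball.
Context {R : realType} {n : nat}.
Local Notation ST := (spacetime R n).
Variables (Omega : set ST) (z0 zc : ST) (R0 : R).
Hypotheses (oO : open Omega) (bz0 : boundary Omega z0).
Hypothesis touch : euclidean_closed_ball zc R0 `&` closure Omega = [set z0].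

Let z0_notin : ~ Omega z0.
Proof. by case: bz0 => _; rewrite ((interior_id _).1 oO). Qed.

Lemma exterior_ball_lt z : closure Omega z -> z <> z0 -> R0 ^+ 2 < sqdist z zc.
Proof.
move=> cz zz0; rewrite ltNge; apply/negP => zR.
have : (euclidean_closed_ball zc R0 `&` closure Omega) z by [].
by rewrite touch.
Qed.

(** If [z0] were in the open ball, nearby points of [Omega] would be in the ball too, and they
    differ from [z0]. *)
Lemma exterior_ball_eq : sqdist z0 zc = R0 ^+ 2.
Proof.
have [zR cz] : (euclidean_closed_ball zc R0 `&` closure Omega) z0 by rewrite touch.
apply/eqP; rewrite eq_le [X in X && _]zR /= leNgt; apply/negP => zlt.
have cs : {for z0, continuous (fun z => sqdist z zc)} by exact: sqdist_continuous.
have near_lt : \forall y \near z0, sqdist y zc < R0 ^+ 2 by apply: (cvgr_lt _ cs).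
have [y [Oy ylt]] := cz _ near_lt.
have yz0 : y <> z0 by move=> yz0; apply: z0_notin; rewrite -yz0.
have := exterior_ball_lt (subset_closure Oy) yz0.
by rewrite ltNge ltW.
Qed.

Lemma exterior_ball_barrier_condition :
  z0 <> (zc.1, zc.2 - R0) -> (z0 = (zc.1, zc.2 + R0) -> 1 <= R0) ->
  exists2 al : R, 0 < al &
    \forall z \near z0, Omega z -> barrier_condition al zc z.
Proof.
move=> not_south north.
pose s z := \sum_(i < n) (coord (Some i) z - coord (Some i) zc) ^+ 2.
pose tau (z : ST) := coord None z - coord None zc.
have sqE z : sqdist z zc = s z + tau z ^+ 2 by [].
have s_ge0 z : 0 <= s z by apply: sumr_ge0 => i _; exact: sqr_ge0.
have ctau : {for z0, continuous tau}.
  by apply: cvgB; [exact: coord_continuous|exact: cvg_cst].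
have cs : {for z0, continuous s}.
  rewrite (_ : s = fun z => sqdist z zc - tau z * tau z); last first.
    by apply/funext => z; rewrite sqE expr2 addrK.
  by apply: cvgB; [exact: sqdist_continuous|exact: cvgM].
have [s0|sn0] := eqVneq (s z0) 0.
  have x0E : z0.1 = zc.1.
    apply/rowP => i; apply/eqP; rewrite -subr_eq0 -sqrf_eq0; apply/eqP.
    have sq_ge0 (j : 'I_n) : true -> 0 <= (coord (Some j) z0 - coord (Some j) zc) ^+ 2.
      by rewrite sqr_ge0.
    exact: (psumr_eq0P sq_ge0 s0).
  have z0E : z0 = (zc.1, z0.2) by rewrite -x0E; case: (z0).
  (* Without spatial offset the contact point is a pole, and [tau z0 = - R0] is the excluded south
     pole. *)
  have /eqP : tau z0 ^+ 2 = R0 ^+ 2 by rewrite -exterior_ball_eq sqE s0 add0r.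
  rewrite eqf_sqr => /orP[/eqP|/eqP] tauE; last first.
    exfalso; apply: not_south; rewrite {1}z0E; congr pair.
    by rewrite -tauE /tau /=; ring.
  have R1 : 1 <= R0.
    apply: north; rewrite {1}z0E; congr pair.
    by rewrite -tauE /tau /=; ring.
  exists 1 => //; have tau_gt0 : \forall z \near z0, 0 < tau z.
    by apply: (cvgr_gt _ ctau); rewrite tauE (lt_le_trans ltr01).
  apply: filterS tau_gt0 => z t0 Oz; rewrite /barrier_condition -/(tau z) -/(s z).
  have zz0 : z <> z0 by move=> zz0; apply: z0_notin; rewrite -zz0.
  have := exterior_ball_lt (subset_closure Oz) zz0; rewrite sqE.
  have := s_ge0 z; have : 1 <= R0 ^+ 2 by rewrite expr_ge1// (le_trans ler01).
  (* For 0 < tau <= 1, s > 1 - tau^2 gives tau + 2 s > 1 + (1 - tau) (1 + 2 tau) >= 1. *)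
  by have [t1|t1] := ltP 1 (tau z); nra.
have s_gt0 : 0 < s z0 by rewrite lt_def sn0 s_ge0.
(* Near [z0] this yields tau + 2 al s > (tau z0 - 1) + (|tau z0| + 3) >= 2. *)
pose al := (`|tau z0| + 3) / s z0.
have alE : al * s z0 = `|tau z0| + 3 by rewrite /al mulfVK.
have al0 : 0 < al by rewrite divr_gt0// ltr_wpDl.
exists al => //.
have nears : \forall z \near z0, s z0 / 2 < s z.
  by apply: (cvgr_gt _ cs); lra.
have neart : \forall z \near z0, tau z0 - 1 < tau z.
  by apply: (cvgr_gt _ ctau); lra.
apply: filterS2 nears neart => z sz tz _.
rewrite /barrier_condition -/(tau z) -/(s z).
have : al * (s z0 / 2) < al * s z by rewrite ltr_pM2l.
have := ler_norm (- tau z0); rewrite normrN; nra.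
Qed.

Lemma gauss_lt_exterior_ball al z : 0 < al -> closure Omega z -> z <> z0 ->
  gauss al zc z < gauss al zc z0.
Proof.
move=> al0 cz zz0; rewrite ltr_expR !mulNr ltrN2 ltr_pM2l// exterior_ball_eq.
exact: exterior_ball_lt.
Qed.

(** The Gaussian attains its maximum on the compact part of the closure outside the interior of [N],
    and this maximum is below its value at [z0]. If that part is empty, any gap will do. *)
Lemma gauss_gap al (N : set ST) : 0 < al -> compact (closure Omega) ->
  nbhs z0 N -> exists2 d : R, 0 < d & forall z, closure Omega z -> ~ N z ->
    d <= gauss al zc z0 - gauss al zc z.
Proof.
move=> al0 cO Nz0; pose C := closure Omega `&` ~` N°.
have [C0|C0] := pselect (C !=set0); last first.
  exists 1 => // z cz nNz; exfalso; apply: C0; exists z; split=> //.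
  by move=> /interior_subset.
have cC : compact C.
  apply: subclosed_compact cO (@subIsetl _ _ _).
  by apply: closedI; [exact: closed_closure|exact/open_closedC/open_interior].
have cg : {within C, continuous (gauss al zc)}.
  by apply: continuous_subspaceT; exact: gauss_continuous.
have [p /[!inE] Cp pmax] := compact_EVT_max C0 cC cg.
exists (gauss al zc z0 - gauss al zc p).
  rewrite subr_gt0; apply: gauss_lt_exterior_ball => //; first by case: Cp.
  by move=> pz0; case: Cp => _; apply; rewrite pz0.
move=> z cz nNz; rewrite lerB// pmax// inE; split=> //.
by move=> /interior_subset.
Qed.

End exterior_ball.

(** * Squeezing the Perron solution at the contact point *)

Theorem theorem4p6 (R : realType) (n : nat) (n_gt0 : (0 < n)%N)
    (Omega : set (spacetime R n)) (x0 x' : 'rV[R]_n) (t0 t' R0 : R) :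
  domain Omega -> bounded_set Omega ->
  boundary Omega (x0, t0) ->
  0 < R0 ->
  euclidean_closed_ball (x', t') R0 `&` closure Omega = [set (x0, t0)] ->
  (x0, t0) <> (x', t' - R0) ->
  ((x0, t0) = (x', t' + R0) -> 1 <= R0) ->
  regular_boundary_point Omega (x0, t0).
Proof.
move=> [_ oO _] bO bz0 R0_gt0 touch not_south north; split=> // f cf.
set z0 := (x0, t0) in bz0 touch not_south north *.
pose zc : spacetime R n := (x', t').
have cO := bounded_compact_closure bO.
have [al al0 good] :=
  exterior_ball_barrier_condition oO bz0 touch not_south north.
have [M M0 fM] : exists2 M : R, 0 < M &
    forall zeta, boundary Omega zeta -> `|f zeta| <= M.
  have cbd : compact (boundary Omega).
    apply: subclosed_compact cO (@subIsetl _ _ _).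
    by apply: closedI; [exact: closed_closure|exact/open_closedC/open_interior].
  have /compact_bounded /pinfty_ex_gt0[M M0 fM] := continuous_compact cf cbd.
  by exists M => // zeta bzeta; apply: fM; exists zeta.
have [T T0 OT] : exists2 T : R, 0 < T & forall z, Omega z -> `|z| <= T.
  by have /pinfty_ex_gt0[T T0 OT] := bO; exists T.
pose G0 := gauss al zc z0.
have G_le z : closure Omega z -> gauss al zc z <= G0.
  have [->//|/eqP zz0] := eqVneq z z0.
  by move=> cz; apply/ltW/(gauss_lt_exterior_ball oO bz0 touch).
(* The factor [G0 - gauss al zc z] is nonnegative on the closure and tends to 0 at [z0]. *)
have bounds (e : R) : 0 < e -> exists K : R, forall z, Omega z ->
    ((f z0 - e - K * (G0 - gauss al zc z))%:E <= lower_perron Omega f z)%E /\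
    (lower_perron Omega f z <= (f z0 + e + K * (G0 - gauss al zc z))%:E)%E.
  move=> e0.
  have nearf : \forall zeta \near z0, boundary Omega zeta -> `|f z0 - f zeta| <= e.
    have /cvgrPdist_le /(_ _ e0) := (@subspace_continuousP _ _ _ f).1 cf _ bz0.
    by rewrite near_withinE.
  pose N z := (Omega z -> barrier_condition al zc z) /\
              (boundary Omega z -> `|f z0 - f z| <= e).
  have [d d0 gap] := gauss_gap oO bz0 touch al0 cO (filterI good nearf).
  (* Off [N] the upper barrier is then at least -M + (2M + 1) = M + 1, the a priori bound for the
     lower class, and the lower one at most M - (2M + 1) < -M, the cut-off level. *)
  pose K := (2 * M + 1) / d.
  have K0 : 0 < K by rewrite divr_gt0//; lra.
  have Kd : K * d = 2 * M + 1 by rewrite mulfVK// lt0r_neq0.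
  have far z : closure Omega z -> ~ N z -> 2 * M + 1 <= K * (G0 - gauss al zc z).
    by move=> cz nN; rewrite -Kd ler_pM2l//; exact: gap.
  have KG z : closure Omega z -> 0 <= K * (G0 - gauss al zc z).
    by move=> cz; rewrite mulr_ge0 ?(ltW K0)// subr_ge0 G_le.
  have upE z : barrier (f z0 + e + K * G0) (- K) al zc z =
               f z0 + e + K * (G0 - gauss al zc z).
    by rewrite /barrier; ring.
  have lowE z : barrier (f z0 - e - K * G0) K al zc z =
               f z0 - e - K * (G0 - gauss al zc z).
    by rewrite /barrier; ring.
  have := fM z0 bz0; rewrite ler_norml => /andP[fz0l fz0u].
  have bdP zeta : boundary Omega zeta ->
      f z0 - e - K * (G0 - gauss al zc zeta) <= f zeta /\
      f zeta <= f z0 + e + K * (G0 - gauss al zc zeta).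
    move=> bzeta; have [czeta _] := bzeta; have KGz := KG _ czeta.
    have := fM _ bzeta; rewrite ler_norml => /andP[fl fu].
    have [|/(far _ czeta) farz] := pselect (N zeta).
      move=> [_ /(_ bzeta)]; rewrite ler_norml => /andP[? ?]; split; lra.
    split; lra.
  exists K => z Oz; split.
    have low := @max_barrier_lower_class _ _ Omega f (f z0 - e - K * G0) K al zc
      (- M) oO al0 (ltW K0).
    apply: (@le_trans _ _ (Num.max (barrier (f z0 - e - K * G0) K al zc z) (- M))%:E).
      by rewrite lee_fin le_max lowE lexx.
    apply: ereal_sup_ubound.
    exists (EFin \o
      (fun y => Num.max (barrier (f z0 - e - K * G0) K al zc y) (- M))) => //.
    apply: low => [y Oy|zeta bzeta].
      rewrite lowE => Mlt.
      have [[+ _]|/(far _ (subset_closure Oy)) fary] := pselect (N y); first exact.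
      lra.
    rewrite lowE ge_max (bdP _ bzeta).1 /=.
    by have := fM _ bzeta; rewrite ler_norml => /andP[].
  apply: ub_ereal_sup => _ [v vL <-].
  have vM y : Omega y -> (v y <= (M + 1)%:E)%E.
    (* Centred far below [Omega], the Gaussian is a global barrier. *)
    pose zb : spacetime R n := (x', - T - 2).
    have gb (y' : spacetime R n) : gauss 1 zb y' <= 1.
      rewrite /gauss -[leRHS]expR0 ler_expR mulNr oppr_le0 mul1r.
      by rewrite addr_ge0 ?sqr_ge0// sumr_ge0// => i _; exact: sqr_ge0.
    (* As the Gaussian is in (0, 1], this barrier is at least [M] on the boundary and below [M + 1]
       everywhere. *)
    move=> Oy; apply: (@le_trans _ _ (barrier (M + 1) (-1) 1 zb y)%:E).
      apply: (lower_class_le_barrier (f := f) oO cO vL) => //.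
        move=> zeta /fM; rewrite ler_norml => /andP[_ fu].
        by rewrite /barrier; have := gb zeta; lra.
      (* On [Omega] the time coordinate is at least [- T], so tau >= 2. *)
      move=> y' Oy'; right; rewrite /barrier_condition.
      have sge0 : 0 <= \sum_(i < n) (coord (Some i) y' - coord (Some i) zb) ^+ 2.
        by apply: sumr_ge0 => i _; exact: sqr_ge0.
      have y2 : `|y'.2| <= T.
        by apply: le_trans (OT _ Oy'); rewrite [leRHS]prod_normE le_max lexx orbT.
      move: y2; rewrite ler_norml /= => /andP[yl _]; lra.
    by rewrite lee_fin /barrier; have := gauss_gt0 1 zb y; lra.
  rewrite -upE.
  apply: (lower_class_le_barrier (f := f) oO cO vL) => //.
  - by rewrite oppr_lt0.
  - by move=> zeta bzeta; rewrite upE; case: (bdP _ bzeta).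
  - move=> y Oy.
    have [[+ _]|/(far _ (subset_closure Oy)) fary] := pselect (N y).
      by move=> /(_ Oy); right.
    left; apply: (le_trans (vM _ Oy)); rewrite upE lee_fin; lra.
have close (e : R) : 0 < e -> \forall z \near within Omega (nbhs z0),
    ((f z0 - e)%:E <= lower_perron Omega f z)%E /\
    (lower_perron Omega f z <= (f z0 + e)%:E)%E.
  move=> e0; have e2 : 0 < e / 2 by lra.
  have [K KP] := bounds _ e2.
  have cK : K * (G0 - gauss al zc z) @[z --> z0] --> K * (G0 - G0).
    apply: cvgM; first exact: cvg_cst.
    by apply: cvgB; [exact: cvg_cst|exact: gauss_continuous].
  rewrite subrr mulr0 in cK.
  have nK : \forall z \near z0, K * (G0 - gauss al zc z) < e / 2.
    exact: (cvgr_lt _ cK).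
  rewrite near_withinE; apply: filterS nK => z zK Oz.
  have [lo up] := KP z Oz; split.
    by apply: le_trans lo; rewrite lee_fin; lra.
  by apply: (le_trans up); rewrite lee_fin; lra.
(* Convergence to a real limit in the extended reals: finiteness nearby, from the bounds with error
   1, and convergence of the real parts. *)
apply/fine_cvgP; split.
  apply: filterS (close 1 ltr01) => z [lo up].
  by rewrite fin_numElt (lt_le_trans (ltNyr _) lo) (le_lt_trans up (ltry _)).
apply/cvgrPdist_le => e e0; apply: filterS (close e e0) => z [].
rewrite /=; case: (lower_perron Omega f z) => [r| |] //.
rewrite !lee_fin => lo up /=.
by rewrite ler_norml; apply/andP; split; lra.
Qed.
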